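(* Let $q\ge1$ be an integer, let the symmetric mean-zero kernels $h_l$ ($l\in\mathcal L$) of order $r$ have degeneracy of order $s\in\{1,\dots,r\}$, and let $n\ge qr$. Then there exist constants $C_{\boldsymbol\alpha}>0$ such that $$U_{n,q}=\sum_{c=qs}^{qr}\ \sum_{\boldsymbol\alpha:\ \sum_t t\alpha_t=c} C_{\boldsymbol\alpha}\,U_{n,\boldsymbol\alpha},$$ where the inner sum is over vectors $\boldsymbol\alpha=(\alpha_1,\dots,\alpha_r)\in\{0,1,2,\dots\}^r$ with $\sum_{t=1}^r\alpha_t=q$ and $\sum_{t=1}^r t\alpha_t=c$.
   Context: $X_1,\dots,X_n$ are i.i.d. random vectors in $\mathbb R^p$, $\mathcal L$ is a finite index set, and for each $l\in\mathcal L$, $h_l:(\mathbb R^p)^r\to\mathbb R$ is an integrable kernel, symmetric in its $r$ arguments, with $\mathbb E[h_l(X_1,\dots,X_r)]=0$. $\sum^*$ denotes summation over mutually distinct indices and $P^n_m=n!/(n-m)!$. Define $$U_{n,q}=\sum_{l\in\mathcal L}(P^n_{qr})^{-1}\sum^*_{1\le i_1,\dots,i_{qr}\le n}\prod_{c=1}^q h_l(X_{i_{(c-1)r+1}},\dots,X_{i_{cr}}).$$ For $1\le t\le r$: projected kernel $h_{l,t}(x_1,\dots,x_t)=\mathbb E[h_l(x_1,\dots,x_t,X_{t+1},\dots,X_r)]$. The kernel has degeneracy of order $s$ if $h_{l,t}\equiv0$ for all $1\le t<s$ while $h_{l,s}\ne0$. The order-$t$ Hájek projection is $$h_l^{(t)}(x_1,\dots,x_t)=\sum_{v=1}^t(-1)^{t-v}\sum_{1\le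 i_1<\cdots<i_v\le t}h_{l,v}(x_{i_1},\dots,x_{i_v}).$$ The tensor product of functions $f,g$ is $(f\otimes g)(x;y)=f(x)g(y)$ (concatenated arguments), and $\otimes^m f$ is the $m$-fold tensor power (an empty factor when $m=0$). For $\boldsymbol\alpha=(\alpha_1,\dots,\alpha_r)$ with nonnegative integer entries, $$h_l^{\boldsymbol\alpha}=[\otimes^{\alpha_1}h_l^{(1)}]\otimes[\otimes^{\alpha_2}h_l^{(2)}]\otimes\cdots\otimes[\otimes^{\alpha_r}h_l^{(r)}],$$ a kernel of order $c=\sum_{t=1}^r t\alpha_t$, and $$U_{n,\boldsymbol\alpha}=(P^n_c)^{-1}\sum_{l\in\mathcal L}\ \sum^*_{1\le i_1,\dots,i_c\le n}h_l^{\boldsymbol\alpha}(X_{i_1},\dots,X_{i_c}).$$ *)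

(* Defs.v *)
From HB Require Import structures.
From mathcomp Require Import all_boot all_order all_algebra perm.
From mathcomp Require Import all_classical all_reals all_analysis.

Set Implicit Arguments.
Unset Strict Implicit.
Unset Printing Implicit Defensive.

Import Order.TTheory GRing.Theory Num.Theory.
Local Open Scope classical_set_scope.
Local Open Scope ring_scope.

(* Indices of arguments and observations are shifted by one with respect to
   the usual notation: X_1, X_2, ... are written X 0, X 1, ... *)

Section sample.
Context {d d' : measure_display} {Omega : measurableType d}
  {V : measurableType d'} {R : realType}.
Variable P : probability Omega R.

Definition mutually_independent (n : nat) (X : nat -> {RV P >-> V}) : Prop :=
  forall (J : {set 'I_n}) (A : 'I_n -> set V),
    (forall i, measurable (A i)) ->
    (P (\bigcap_(i in [set` J]) (X i @^-1` A i)) =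
     \prod_(i in J) P (X i @^-1` A i))%E.

Definition identically_distributed (n : nat) (X : nat -> {RV P >-> V}) : Prop :=
  forall (i j : 'I_n) (A : set V), measurable A ->
    P (X i @^-1` A) = P (X j @^-1` A).

(* X 0, ..., X (n-1) are i.i.d.; nothing is assumed on the later X i. *)
Definition iid (n : nat) (X : nat -> {RV P >-> V}) : Prop :=
  mutually_independent n X /\ identically_distributed n X.

Section kernel.
Variables (X : nat -> {RV P >-> V}) (r : nat) (h : r.-tuple V -> R).

Definition symmetric_kernel : Prop :=
  forall (sigma : 'S_r) (x : r.-tuple V),
    h [tuple tnth x (sigma i) | i < r] = h x.

Definition integrable_kernel : Prop :=
  measurable_fun setT h /\
  P.-integrable setT (fun w => (h [tuple X i w | i < r])%:E).

Definition mean_zero_kernel : Prop :=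
  ('E_P[(fun w => h [tuple X i w | i < r])] = 0)%E.

(* h_t(x_1, ..., x_t) = E[h(x_1, ..., x_t, X_(t+1), ..., X_r)] for t <= r:
   [nth (X i w) x i] is x_i for i < t and X_i(w) otherwise.  This integral is
   only guaranteed to exist for almost every (x_1, ..., x_t), so that h_t is
   meaningful up to a null set of the law of (X_1, ..., X_t). *)
Definition projected_kernel (t : nat) (x : t.-tuple V) : R :=
  fine 'E_P[(fun w => h [tuple nth (X i w) x i | i < r])].

Definition projected_kernel_null (t : nat) : Prop :=
  {ae P, forall w, projected_kernel [tuple X i w | i < t] = 0}.

Definition degeneracy_order (s : nat) : Prop :=
  (forall t, (1 <= t < s)%N -> projected_kernel_null t) /\
  ~ projected_kernel_null s.

(* The inner sum runs over the indices i_1 < ... < i_v. *)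
Definition hajek (t : nat) (x : t.-tuple V) : R :=
  \sum_(1 <= v < t.+1) (-1) ^+ (t - v) *
    \sum_(i : v.-tuple 'I_t | sorted ltn (map val i))
      projected_kernel (map_tuple (tnth x) i).

End kernel.
End sample.

Section tensor.
Variables (V : Type) (R : realType).

(* Kernels packaged with their order, so that tensor products of kernels of
   various orders can be iterated. *)
Definition ukernel : Type := {m : nat & m.-tuple V -> R}.

Definition UKernel (m : nat) (f : m.-tuple V -> R) : ukernel :=
  existT (fun m : nat => m.-tuple V -> R) m f.

Definition tensor (f g : ukernel) : ukernel :=
  @UKernel (tag f + tag g)%N (fun x =>
    tagged f [tuple tnth x (lshift (tag g) i) | i < tag f] *
    tagged g [tuple tnth x (rshift (tag f) i) | i < tag g]).

Definition tensor_one : ukernel := @UKernel 0%N (fun=> 1).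

Definition tensor_power (m : nat) (f : ukernel) : ukernel :=
  iter m (tensor f) tensor_one.

End tensor.

(* A vector alpha = (alpha_1, ..., alpha_r) of nonnegative integers bounded
   by q; the entry alpha_t is [alpha t'] with t' = t - 1.  The bound is no
   restriction when alpha_1 + ... + alpha_r = q. *)
Notation multiindex r q := {ffun 'I_r -> 'I_q.+1}.

Section alpha.
Variables (r q : nat).

Definition alpha_size (alpha : multiindex r q) : nat :=
  (\sum_(t < r) alpha t)%N.

Definition alpha_order (alpha : multiindex r q) : nat :=
  (\sum_(t < r) t.+1 * alpha t)%N.

End alpha.

Section tensor_kernel.
Context {d d' : measure_display} {Omega : measurableType d}
  {V : measurableType d'} {R : realType}.
Variables (P : probability Omega R) (X : nat -> {RV P >-> V}).
Variables (r q : nat).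

Definition hajek_tensor (h : r.-tuple V -> R) (alpha : multiindex r q) :
    ukernel V R :=
  \big[@tensor V R/tensor_one V R]_(t < r)
    tensor_power (alpha t) (UKernel (hajek X h (t := t.+1))).

Lemma tag_tensor_power (m : nat) (f : ukernel V R) :
  tag (tensor_power m f) = (tag f * m)%N.
Proof.
by elim: m => [|m IH]; rewrite ?muln0// mulnS -IH.
Qed.

Lemma tag_hajek_tensor (h : r.-tuple V -> R) (alpha : multiindex r q) :
  tag (hajek_tensor h alpha) = alpha_order alpha.
Proof.
rewrite /hajek_tensor /alpha_order (big_morph (fun k : ukernel V R => tag k)
  (id1 := 0%N) (op1 := addn))//.
by apply: eq_bigr => t _; rewrite tag_tensor_power.
Qed.

End tensor_kernel.

Lemma block_proof (q r : nat) (c : 'I_q) (k : 'I_r) : (c * r + k < q * r)%N.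
Proof.
have: (c.+1 * r <= q * r)%N by rewrite leq_mul2r ltn_ord orbT.
by apply: leq_trans; rewrite mulSn addnC ltn_add2r.
Qed.

(* The k-th index of the c-th of q consecutive blocks of length r. *)
Definition block (q r : nat) (c : 'I_q) (k : 'I_r) : 'I_(q * r) :=
  Ordinal (block_proof c k).

Section U_statistics.
Context {d d' : measure_display} {Omega : measurableType d}
  {V : measurableType d'} {R : realType}.
Variables (P : probability Omega R) (X : nat -> {RV P >-> V}).
Variables (L : finType) (r q n : nat) (h : L -> r.-tuple V -> R).

(* P^n_m is the falling factorial [n ^_ m], and the sums over mutually
   distinct indices are sums over duplicate-free tuples. *)
Definition U_q (w : Omega) : R :=
  \sum_(l : L) ((n ^_ (q * r))%:R)^-1 *
    \sum_(i : (q * r).-tuple 'I_n | uniq i)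
      \prod_(c < q) h l [tuple X (tnth i (block c k)) w | k < r].

Definition U_alpha (alpha : multiindex r q) (w : Omega) : R :=
  ((n ^_ (alpha_order alpha))%:R)^-1 *
  \sum_(l : L) let f := hajek_tensor X (h l) alpha in
    \sum_(i : (tag f).-tuple 'I_n | uniq i)
      tagged f [tuple X (tnth i j) w | j < tag f].

End U_statistics.

(* Main.v *)
From HB Require Import structures.
Require Import Defs.
From mathcomp Require Import all_boot all_order all_algebra.
From mathcomp Require Import perm action primitive_action alt.
From mathcomp Require Import all_classical all_reals all_analysis.
From mathcomp Require Import measurable_realfun.

Set Implicit Arguments.
Unset Strict Implicit.
Unset Printing Implicit Defensive.

Import Order.TTheory GRing.Theory Num.Theory.
Local Open Scope ring_scope.

(* By inclusion-exclusion, h(x_1, ..., x_r) is the sum over the nonempty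
   subsets A of {1, ..., r} of the Hajek projection of order #|A| evaluated at
   x_A; this holds pointwise.  Expanding the product of the q kernels, every
   choice of q nonempty subsets yields, up to a relabelling of the
   observations, the tensor kernel of the multi-index counting the subsets of
   each size.  The mean of a function of k distinct indices over all such
   indices is its mean over the permutations of {1, ..., n} applied to one
   fixed choice of indices, hence it is insensitive both to the relabelling
   and to the indices that no longer occur.  So C_alpha is the number of
   choices with multi-index alpha.  Finally a multi-index of order less than
   q s has a factor of order t < s, which is a combination of projected kernels
   of order less than s; these vanish almost surely at any distinct
   observations, as they do at X_1, X_2, ... *)

(** * Increasing tuples, signed subset sums and averages over permutations *)

Lemma sorted_enum_set m (A : {set 'I_m}) : sorted ltn (map val (enum A)).
Proof.
rewrite -[enum _](eq_filter (mem_enum _)).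
rewrite -(eq_filter (mem_map val_inj _)) -filter_map.
by rewrite (sorted_filter ltn_trans) // unlock val_ord_enum iota_ltn_sorted.
Qed.

Lemma ltn_sorted_eq m (s1 s2 : seq 'I_m) :
  sorted ltn (map val s1) -> sorted ltn (map val s2) -> s1 =i s2 -> s1 = s2.
Proof.
move=> h1 h2 e; apply: (inj_map val_inj).
apply: (irr_sorted_eq ltn_trans ltnn) => // y.
by apply/mapP/mapP => -[x xs ->]; exists x; rewrite // ?e // -e.
Qed.

Lemma ltn_sorted_uniq m (s : seq 'I_m) : sorted ltn (map val s) -> uniq s.
Proof.
by move=> ss; rewrite -(map_inj_uniq val_inj); apply: (sorted_uniq ltn_trans ltnn).
Qed.

Lemma enum_set_sorted m (s : seq 'I_m) :
  sorted ltn (map val s) -> enum [set x in s] = s.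
Proof.
move=> ss; apply: ltn_sorted_eq => //; first exact: sorted_enum_set.
by move=> x; rewrite mem_enum inE.
Qed.

(** An increasing tuple is the enumeration of its set of entries, so [enum] inverts the passage from
    tuples to sets. *)
Lemma sum_sorted_tuple (R : nmodType) m k (F : {set 'I_m} -> R) :
  \sum_(i : k.-tuple 'I_m | sorted ltn (map val i)) F [set x in i] =
  \sum_(A : {set 'I_m} | #|A| == k) F A.
Proof.
(* The inverse map below uses [nth], whose default must be an element of ['I_m]; hence [m = 0] is
   treated apart. *)
have [m0|m_gt0] := posnP m; first subst m.
  case: k => [|k].
    rewrite (bigD1 [tuple])//= [X in _ + X]big1 ?addr0; last first.
      by move=> i /andP[_ /eqP[]]; rewrite (tuple0 i).
    rewrite (bigD1 finset.set0) ?cards0//= [X in _ = _ + X]big1 ?addr0.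
      by congr F; apply/setP => -[].
    by move=> A /andP[/eqP/cards0_eq-> /eqP].
  rewrite !big1 // => [A /eqP|]; last by case/tupleP=> -[].
  by have := max_card [in A]; rewrite card_ord => + E; rewrite E.
pose i0 := Ordinal m_gt0.
pose f_A (A : {set 'I_m}) := [tuple of mkseq (nth i0 (enum A)) k].
have val_fA (A : {set 'I_m}) : #|A| = k -> val (f_A A) = enum A.
  by move=> Am; rewrite -[enum _](mkseq_nth i0) -cardE Am.
rewrite [RHS](reindex_onto (fun t : k.-tuple 'I_m => [set x in t]) f_A) /=; last first.
  by move=> A /eqP cA; apply/setP=> x; rewrite inE -(mem_enum A) -val_fA.
apply: eq_bigl => t; apply/idP/andP => [st|[/eqP ct /eqP <-]]; last first.
  by rewrite val_fA//; exact: sorted_enum_set.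
have ct : #|[set x in t]| = k.
  by rewrite cardsE (card_uniqP _) ?size_tuple// ltn_sorted_uniq.
rewrite ct eqxx -val_eqE val_fA// -(inj_eq (inj_map val_inj)).
by rewrite enum_set_sorted.
Qed.

(** Möbius inversion on the subset lattice: after exchanging the sums, the coefficient of [G B] is
    an alternating sum over the supersets of [B], which cancels unless [B] is full. *)
Lemma sum_signed_subsets (R : comPzRingType) (I : finType) (G : {set I} -> R) :
  \sum_(A : {set I}) \sum_(B : {set I} | B \subset A)
    (-1) ^+ (#|A| - #|B|) * G B = G [set: I].
Proof.
rewrite (exchange_big_dep xpredT)//= (bigD1 [set: I])//= [X in _ + X]big1 ?addr0.
  rewrite (big_pred1 [set: I]) ?subnn ?mul1r// => A.
  by rewrite finset.subTset.
move=> B BT; rewrite -mulr_suml.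
suff -> : \sum_(A : {set I} | B \subset A) (-1) ^+ (#|A| - #|B|) = 0 :> R.
  by rewrite mul0r.
have [x xB] : exists x, x \notin B.
  have /subsetPn[x _ xB] : ~~ ([set: I] \subset B) by rewrite finset.subTset.
  by exists x.
(* When the product is expanded, the first summand stands for [i] in [A] and the second for [i]
   outside [A]. The 0 discards every [A] that misses a point of [B], and each point outside [B]
   gives a factor [-1 + 1]. *)
transitivity (\prod_i ((if i \in B then 1 else -1) + (if i \in B then 0 else 1)) : R).
  rewrite bigA_distr big_mkcond/=; apply: eq_bigr => A _.
  case: ifPn => [sBA|/subsetPn[y yB yA]]; last first.
    by rewrite (bigD1 y)//= (negbTE yA) yB mul0r.
  rewrite -cardsDS // -prodr_const big_mkcond/=.
  apply: eq_bigr => i _; rewrite inE.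
  by have := fintype.subsetP sBA i; case: (i \in A); case: (i \in B) => // /(_ isT).
by rewrite (bigD1 x)//= (negbTE xB) addNr mul0r.
Qed.

(** The symmetric group is [n]-transitive, hence [k]-transitive for [k <= n]. *)
Lemma uniq_tuple_perm n k (e f : k.-tuple 'I_n) : uniq e -> uniq f ->
  exists s : 'S_n, map_tuple s e = f.
Proof.
move=> ue uf.
have kn : (k <= #|'I_n|)%N.
  by rewrite -(size_tuple e) -(card_uniqP ue) max_card.
have tr := ntransitive_weak kn (@Sym_trans 'I_n).
have dP (g : k.-tuple 'I_n) : uniq g -> g \in dtuple_on k [set: 'I_n].
  by move=> ug; rewrite inE ug/=; apply/fintype.subsetP => x; rewrite inE.
have [s _ ->] := atransP2 tr (dP _ ue) (dP _ uf).
by exists s; apply: eq_from_tnth => i; rewrite /n_act !tnth_map.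
Qed.

(** Double counting of pairs of an injective tuple and a permutation: by transitivity the sum over
    permutations is the same for every tuple, and each permutation permutes the injective tuples. *)
Lemma sum_perm_uniq_tuple (R : pzRingType) n k (F : k.-tuple 'I_n -> R)
    (e : k.-tuple 'I_n) : uniq e ->
  (n ^_ k)%:R * \sum_(s : 'S_n) F (map_tuple s e) =
  n`!%:R * \sum_(i : k.-tuple 'I_n | uniq i) F i.
Proof.
move=> ue.
have indep (f : k.-tuple 'I_n) : uniq f ->
    \sum_(s : 'S_n) F (map_tuple s f) = \sum_(s : 'S_n) F (map_tuple s e).
  move=> uf; have [t <-] := uniq_tuple_perm ue uf.
  rewrite [RHS](reindex_inj (mulgI t)); apply: eq_bigr => s _; congr F.
  by apply: eq_from_tnth => i; rewrite !tnth_map permM.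
transitivity (\sum_(f : k.-tuple 'I_n | uniq f) \sum_(s : 'S_n) F (map_tuple s f)).
  rewrite (eq_bigr _ indep) sumr_const -[RHS]mulr_natl; congr (_%:R * _).
  have := card_uniq_tuples k (@predT 'I_n); rewrite card_ord => <-.
  by rewrite cardsE; apply: eq_card => t; rewrite unfold_in all_predT.
rewrite exchange_big/= (eq_bigr (fun=> \sum_(i : k.-tuple 'I_n | uniq i) F i)).
  rewrite sumr_const -[LHS]mulr_natl; congr (_%:R * _).
  by rewrite -card_Sn; apply: eq_card => s; rewrite !inE.
move=> s _; rewrite [RHS](reindex_inj (h := map_tuple s)).
  by apply: eq_bigl => f; rewrite map_inj_uniq//; exact: perm_inj.
move=> f g /(congr1 val)/= /inj_map h; apply: val_inj; apply: h; exact: perm_inj.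
Qed.

(** * Pointwise Hoeffding decomposition *)

Section hoeffding.
Context {d d' : measure_display} {Omega : measurableType d}
  {V : measurableType d'} {R : realType}.
Variables (P : probability Omega R) (X : nat -> {RV P >-> V}).
Variables (r : nat) (h : r.-tuple V -> R).

Local Notation pk s := (projected_kernel X h (in_tuple s)).

Lemma hajek_subsets t (x : t.-tuple V) :
  hajek X h x = \sum_(B : {set 'I_t} | B != finset.set0)
    (-1) ^+ (t - #|B|) * pk [seq tnth x i | i <- enum B].
Proof.
rewrite /hajek.
under eq_bigr => v _.
  rewrite (eq_bigr (fun i : v.-tuple 'I_t =>
      pk [seq tnth x j | j <- enum [set j in i]])); last first.
    by move=> i si; rewrite enum_set_sorted.
  rewrite (sum_sorted_tuple v (fun B => pk [seq tnth x j | j <- enum B])) mulr_sumr.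
  over.
rewrite big_nat_cond (exchange_big_dep (fun B : {set 'I_t} => B != finset.set0))/=; last first.
  by move=> v B /andP[/andP[v1 _] _] /eqP Bv; rewrite -card_gt0 Bv.
apply: eq_bigr => B B0.
under eq_bigl => v do rewrite andbT eq_sym.
rewrite -big_nat_cond big_nat1_eq ltnS card_gt0 B0/=.
by have := max_card [in B]; rewrite card_ord => ->.
Qed.

(** Subsets of positions are carried along [i] to subsets of its entries. The value 0 at the empty
    set puts the sum in the form of the inner sum of [sum_signed_subsets]. *)
Lemma hajek_tnth_subsets t (x : r.-tuple V) (i : t.-tuple 'I_r) :
  sorted ltn (map val i) ->
  hajek X h (map_tuple (tnth x) i) =
  \sum_(B : {set 'I_r} | B \subset [set j in i])
    (-1) ^+ (t - #|B|) *
    (if B == finset.set0 then 0 else pk [seq tnth x j | j <- enum B]).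
Proof.
move=> si.
have ui := ltn_sorted_uniq si.
have inji : injective (tnth i) by exact/tuple_uniqP.
rewrite hajek_subsets.
rewrite [RHS](reindex_onto (fun B : {set 'I_t} => tnth i @: B)
  (fun B => tnth i @^-1: B)) /=; last first.
  move=> B /fintype.subsetP Bi; apply/setP => y; apply/imsetP/idP => [[z]|yB].
    by rewrite inE => + ->.
  have := Bi _ yB; rewrite inE => /tnthP[z yz].
  by exists z; rewrite ?inE -?yz.
rewrite big_mkcond/= [RHS]big_mkcond/=; apply: eq_bigr => B _.
have -> : tnth i @^-1: (tnth i @: B) = B.
  by apply/setP => z; rewrite inE mem_imset.
rewrite eqxx andbT.
have -> : tnth i @: B \subset [set j in i].
  by apply/fintype.subsetP => y /imsetP[z _ ->]; rewrite inE mem_tnth.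
rewrite imset_eq0; case: ifPn => [B0|/negPn/eqP ->]; last first.
  by rewrite eqxx mulr0.
rewrite (negbTE B0) card_imset//; congr (_ * pk _).
(* As [i] is increasing, it maps the increasing enumeration of [B] to that of its image, so the
   arguments keep their order. *)
have -> : enum (tnth i @: B) = map (tnth i) (enum B).
  apply: ltn_sorted_eq; first exact: sorted_enum_set.
    rewrite -map_comp.
    have : sorted ltn (map val (enum B)) := sorted_enum_set B.
    rewrite !sorted_map; apply: sub_sorted => a b /= ab.
    rewrite /relpre/=.
    have -> : (tnth i a < tnth i b)%N = (nth 0%N (map val i) a < nth 0%N (map val i) b)%N.
      by rewrite !(nth_map (tnth i a)) ?size_tuple// -!tnth_nth.
    apply: (sorted_ltn_nth ltn_trans) => //; rewrite inE size_map size_tuple; exact: ltn_ord.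
  move=> y; rewrite mem_enum; apply/imsetP/mapP => -[z zB ->]; exists z => //.
    by rewrite mem_enum.
  by rewrite mem_enum in zB.
by rewrite -map_comp; apply: eq_map => z; rewrite /= tnth_map.
Qed.

Lemma projected_kernel_full (x : r.-tuple V) : projected_kernel X h x = h x.
Proof.
rewrite /projected_kernel.
have -> : (fun w => h [tuple nth (X i w) x i | i < r]) = fun=> h x.
  apply/funext => w; congr h; apply: eq_from_tnth => i.
  by rewrite tnth_mktuple (tnth_nth (X i w)).
by rewrite expectation_cst.
Qed.

Lemma hoeffding (x : r.-tuple V) : (0 < r)%N ->
  h x = \sum_(t < r) \sum_(i : t.+1.-tuple 'I_r | sorted ltn (map val i))
    hajek X h (map_tuple (tnth x) i).
Proof.
move=> r0.
pose G (B : {set 'I_r}) :=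
  if B == finset.set0 then 0 else pk [seq tnth x j | j <- enum B].
have -> : h x = G [set: 'I_r].
  rewrite /G ifF; last first.
    by apply/negbTE/set0Pn; exists (Ordinal r0).
  rewrite -projected_kernel_full.
  have -> : [seq tnth x j | j <- enum [set: 'I_r]] = x.
    by rewrite -[RHS]map_tnth_enum; congr map; rewrite enum_setT enumT.
  by [].
rewrite -sum_signed_subsets.
under [RHS]eq_bigr => t _.
  rewrite (eq_bigr (fun i : t.+1.-tuple 'I_r =>
    \sum_(B : {set 'I_r} | B \subset [set j in i])
      (-1) ^+ (#|[set j in i]| - #|B|) * G B)); last first.
    move=> i si; rewrite hajek_tnth_subsets//.
    by rewrite cardsE (card_uniqP (ltn_sorted_uniq si)) size_tuple.
  rewrite (sum_sorted_tuple t.+1 (fun A : {set 'I_r} =>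
    \sum_(B : {set 'I_r} | B \subset A) (-1) ^+ (#|A| - #|B|) * G B)).
  over.
(* The empty set contributes 0, in agreement with the absence of a projection of order 0. *)
rewrite (bigD1 finset.set0)//= big1 ?add0r; last first.
  by move=> B; rewrite finset.subset0 => /eqP ->; rewrite /G eqxx mulr0.
rewrite [RHS](exchange_big_dep (fun A : {set 'I_r} => A != finset.set0))/=; last first.
  by move=> t A _ /eqP tA; rewrite -card_gt0 tA.
apply: eq_bigr => A A0.
have Ar : (#|A|.-1 < r)%N.
  by rewrite prednK ?card_gt0//; have := max_card [in A]; rewrite card_ord.
rewrite (big_pred1 (Ordinal Ar))// => t.
rewrite /= -val_eqE/= -[in LHS](prednK (n := #|A|)) ?card_gt0// eqSS.
by rewrite eq_sym.
Qed.

End hoeffding.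

(** * Means over distinct indices, and tensor kernels at index sequences *)

Lemma widen_ord_inj m n (le_mn : (m <= n)%N) : injective (widen_ord le_mn).
Proof. by move=> i j /(congr1 val) ij; exact: val_inj. Qed.

(** The right side is an average over the same group for every [k], which makes means over tuples of
    different lengths comparable. *)
Lemma mean_uniq_tuple (R : numFieldType) n k (F : k.-tuple 'I_n -> R)
    (e : k.-tuple 'I_n) : uniq e ->
  (n ^_ k)%:R^-1 * (\sum_(i : k.-tuple 'I_n | uniq i) F i) =
  n`!%:R^-1 * \sum_(s : 'S_n) F (map_tuple s e).
Proof.
move=> ue; have := sum_perm_uniq_tuple F ue.
have nk : (n ^_ k)%:R != 0 :> R.
  rewrite pnatr_eq0 -lt0n ffact_gt0 -(size_tuple e) -(card_uniqP ue).
  by rewrite -[leqRHS]card_ord max_card.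
have n0 : n`!%:R != 0 :> R by rewrite pnatr_eq0 -lt0n fact_gt0.
by move=> /(canRL (mulKf nk)) ->; rewrite mulrCA mulKf.
Qed.

Lemma uniq_flatten_map (I T : eqType) (J : I -> seq T) (s : seq I) :
  uniq s -> (forall c, uniq (J c)) ->
  (forall c c' x, x \in J c -> x \in J c' -> c = c') ->
  uniq (flatten [seq J c | c <- s]).
Proof.
move=> + uJ dJ; elim: s => //= c s IH /andP[cs us].
rewrite cat_uniq uJ IH// andbT; apply/hasPn => x /flatten_mapP[c' c's xc'].
by apply: contra cs => xc; rewrite (dJ _ _ _ xc xc').
Qed.

Section realizes.
Variables (V : Type) (R : realType) (n : nat).
Implicit Types (f g : ukernel V R) (j k : seq 'I_n) (Phi Psi : ('I_n -> V) -> R).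

(* The positions j are exposed as a sequence so that tensoring concatenates
   them without casts. *)
Definition realizes f j Phi : Prop :=
  exists2 t : (tag f).-tuple 'I_n, val t = j &
    forall y, Phi y = tagged f (map_tuple y t).

Lemma eq_realizes f j Phi Psi :
  Phi =1 Psi -> realizes f j Phi -> realizes f j Psi.
Proof. by move=> e [t tj fE]; exists t => // y; rewrite -e. Qed.

Lemma realizes_tensor_one : realizes (tensor_one V R) [::] (fun=> 1).
Proof. by exists [tuple]. Qed.

Lemma realizes_tensor f g j k Phi Psi :
  realizes f j Phi -> realizes g k Psi ->
  realizes (tensor f g) (j ++ k) (fun y => Phi y * Psi y).
Proof.
move=> [t <- fE] [u <- gE]; exists [tuple of t ++ u] => // y.
rewrite fE gE /=; congr (tagged f _ * tagged g _); apply: eq_from_tnth => i.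
  by rewrite !tnth_map /= tnth_ord_tuple; congr y; rewrite tnth_lshift.
by rewrite !tnth_map /= tnth_ord_tuple; congr y; rewrite tnth_rshift.
Qed.

Lemma realizes_tensor_power (I : eqType) (s : seq I) f
    (J : I -> seq 'I_n) (Phi : I -> ('I_n -> V) -> R) :
  {in s, forall c, realizes f (J c) (Phi c)} ->
  realizes (tensor_power (size s) f) (flatten [seq J c | c <- s])
    (fun y => \prod_(c <- s) Phi c y).
Proof.
elim: s => [_|c s IH fs] /=.
  by apply: eq_realizes realizes_tensor_one => y; rewrite big_nil.
apply: (@eq_realizes _ _ (fun y => Phi c y * \prod_(c' <- s) Phi c' y)) => [y|].
  by rewrite big_cons.
apply: realizes_tensor; first by apply: fs; rewrite mem_head.
by apply: IH => c' c's; apply: fs; rewrite in_cons c's orbT.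
Qed.

Lemma realizes_big_tensor (I : Type) (s : seq I) (F : I -> ukernel V R)
    (J : I -> seq 'I_n) (Phi : I -> ('I_n -> V) -> R) :
  (forall t, realizes (F t) (J t) (Phi t)) ->
  realizes (\big[@tensor V R/tensor_one V R]_(t <- s) F t)
    (flatten [seq J t | t <- s]) (fun y => \prod_(t <- s) Phi t y).
Proof.
move=> fJ; elim: s => [|t s IH].
  rewrite big_nil.
  by apply: eq_realizes realizes_tensor_one => y; rewrite big_nil.
rewrite big_cons.
apply: (@eq_realizes _ _ (fun y => Phi t y * \prod_(t' <- s) Phi t' y)) => [y|].
  by rewrite big_cons.
exact: realizes_tensor.
Qed.

End realizes.

(* A pair (t, i) with i increasing stands for the nonempty subset of 'I_r with
   elements i; its order as an argument list is t.+1. *)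
Definition subblock r : Type := {t : 'I_r & t.+1.-tuple 'I_r}.
HB.instance Definition _ r := Finite.on (subblock r).

(** * The multi-index of a choice of subsets *)

Section profile.
Variables (r q : nat).
Implicit Types a : {ffun 'I_q -> subblock r}.

Definition profile a : multiindex r q :=
  [ffun t => inord (count (fun c => tag (a c) == t) (index_enum 'I_q))].

(** A count over [q] positions is at most [q], so [inord] never returns its default. *)
Lemma profileE a t :
  profile a t = count (fun c => tag (a c) == t) (index_enum 'I_q) :> nat.
Proof.
rewrite ffunE inordK// ltnS (leq_trans (count_size _ _))//.
by rewrite /index_enum -enumT size_enum_ord.
Qed.

Lemma alpha_size_profile a : alpha_size (profile a) = q.
Proof.
rewrite /alpha_size; under eq_bigr do rewrite profileE -sum1_count.
by rewrite -[RHS]card_ord -sum1_card (partition_big (fun c => tag (a c)) xpredT).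
Qed.

Definition sorted_subblock : pred (subblock r) :=
  fun b => sorted ltn (map val (tagged b)).

Definition alpha_count (alpha : multiindex r q) : nat :=
  #|[pred a in ffun_on sorted_subblock | profile a == alpha]|.

Lemma alpha_count_gt0 (alpha : multiindex r q) :
  alpha_size alpha = q -> (0 < alpha_count alpha)%N.
Proof.
move=> alq.
(* A choice with profile [alpha] is built explicitly: [u] lists each [t] with multiplicity
   [alpha t], and [b t] is the initial segment of length [t.+1]. *)
pose u := flatten [seq nseq (alpha t) t | t <- index_enum 'I_r].
have su : size u == q.
  rewrite size_flatten /shape -map_comp -[X in _ == X]alq /alpha_size sumnE big_map.
  by apply/eqP/eq_bigr => t _; rewrite /= size_nseq.
pose b (t : 'I_r) : subblock r :=
  Tagged (fun t : 'I_r => t.+1.-tuple 'I_r)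
    [tuple widen_ord (ltn_ord t) i | i < t.+1].
apply/card_gt0P; exists [ffun c => b (tnth (Tuple su) c)]; rewrite inE.
apply/andP; split.
  apply/ffun_onP => c; rewrite ffunE unfold_in /sorted_subblock /= -map_comp.
  rewrite (eq_map (g := val))// val_enum_ord; exact: iota_ltn_sorted.
apply/eqP/ffunP => t; apply: val_inj; rewrite [LHS]profileE.
under eq_count do rewrite ffunE /=.
have -> : count (fun c => tnth (Tuple su) c == t) (index_enum 'I_q) = count_mem t u.
  by rewrite -[RHS](congr1 (count_mem t) (map_tnth_enum (Tuple su))) count_map enumT.
rewrite count_flatten -map_comp sumnE big_map (bigD1 t)//=.
rewrite count_nseq /= eqxx mul1n big1 ?addn0// => t' /negbTE t't.
by rewrite count_nseq /= t't.
Qed.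

End profile.

(** * Expansion of the mean of a product of kernels *)

Section decomposition.
Context {d d' : measure_display} {Omega : measurableType d}
  {V : measurableType d'} {R : realType}.
Variables (P : probability Omega R) (X : nat -> {RV P >-> V}).
Variables (r q n : nat) (h : r.-tuple V -> R).

(** Sorting the factors by the size of their subsets turns the product into the tensor kernel; [t]
    concatenates their index lists in that order. It is chosen before [y], so one [t] serves all
    permutations of the observations. *)
Lemma prod_hajek_tensor (e : 'I_(q * r) -> 'I_n) (a : {ffun 'I_q -> subblock r}) :
  injective e -> a \in ffun_on (@sorted_subblock r) ->
  exists2 t : (tag (hajek_tensor X h (profile a))).-tuple 'I_n, uniq t &
    forall y : 'I_n -> V,
      \prod_(c < q) hajek X h (map_tuple (fun k => y (e (block c k))) (tagged (a c)))
      = tagged (hajek_tensor X h (profile a)) (map_tuple y t).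
Proof.
move=> ei /ffun_onP asort.
pose s (t : 'I_r) := [seq c <- index_enum 'I_q | tag (a c) == t].
pose J (c : 'I_q) := [seq e (block c k) | k <- tagged (a c)].
pose Phi (c : 'I_q) (y : 'I_n -> V) :=
  hajek X h (map_tuple (fun k => y (e (block c k))) (tagged (a c))).
have : realizes (hajek_tensor X h (profile a))
    (flatten [seq flatten [seq J c | c <- s t] | t <- index_enum 'I_r])
    (fun y => \prod_(t < r) \prod_(c <- s t) Phi c y).
  have -> : hajek_tensor X h (profile a) = \big[@tensor V R/tensor_one V R]_(t < r)
      tensor_power (size (s t)) (UKernel (hajek X h (t := t.+1))).
    by apply: eq_bigr => t _; rewrite profileE size_filter.
  apply: realizes_big_tensor => t; apply: realizes_tensor_power => c.
  rewrite mem_filter => /andP[/eqP <- _].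
  exists (map_tuple (fun k => e (block c k)) (tagged (a c))) => // y.
  by rewrite /Phi /=; congr hajek; apply: eq_from_tnth => i; rewrite !tnth_map.
move=> [t tE PhiE]; exists t.
  (* Quotient and remainder by [r] recover the block and the position in it, so different blocks use
     disjoint indices. *)
  have blockK c k c' k' : e (block c k) = e (block c' k') -> c = c' /\ k = k'.
    move=> /ei /(congr1 val) /= E; have r0 : (0 < r)%N by apply: leq_trans (ltn_ord k).
    split; apply: val_inj.
      move/(congr1 (divn^~ r)): E.
      by rewrite !divnMDl// !divn_small ?ltn_ord// !addn0.
    by move/(congr1 (modn^~ r)): E; rewrite !modnMDl !modn_small ?ltn_ord.
  have dJ c c' x : x \in J c -> x \in J c' -> c = c'.
    by move=> /mapP[k _ ->] /mapP[k' _ /blockK[]].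
  have us t' : uniq (s t') by rewrite filter_uniq// index_enum_uniq.
  rewrite tE; apply: uniq_flatten_map => [|t'|t1 t2 x]; first exact: index_enum_uniq.
    apply: uniq_flatten_map => // c.
    rewrite map_inj_uniq; first exact: ltn_sorted_uniq (asort c).
    by move=> k k' /blockK[].
  move=> /flatten_mapP[c + xc] /flatten_mapP[c' + xc'].
  by rewrite (dJ _ _ _ xc xc') !mem_filter => /andP[/eqP <- _] /andP[/eqP <- _].
move=> y; rewrite -PhiE.
under [RHS]eq_bigr do rewrite big_filter.
by rewrite (partition_big (fun c => tag (a c)) xpredT).
Qed.

Lemma mean_prod_kernel (y : 'I_n -> V) : (0 < r)%N -> (q * r <= n)%N ->
  (n ^_ (q * r))%:R^-1 * (\sum_(i : (q * r).-tuple 'I_n | uniq i)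
    \prod_(c < q) h [tuple y (tnth i (block c k)) | k < r]) =
  \sum_(alpha : multiindex r q | alpha_size alpha == q)
    (alpha_count alpha)%:R * ((n ^_ (alpha_order alpha))%:R^-1 *
      \sum_(i : (tag (hajek_tensor X h alpha)).-tuple 'I_n | uniq i)
        tagged (hajek_tensor X h alpha) (map_tuple y i)).
Proof.
move=> r0 qrn.
pose M (alpha : multiindex r q) := (n ^_ (alpha_order alpha))%:R^-1 *
  \sum_(i : (tag (hajek_tensor X h alpha)).-tuple 'I_n | uniq i)
        tagged (hajek_tensor X h alpha) (map_tuple y i).
(* The fixed choice of indices is the first [q * r] ones. *)
pose e := map_tuple (widen_ord qrn) (ord_tuple (q * r)).
have inj_e : injective (widen_ord qrn) by exact: widen_ord_inj.
have ue : uniq e by rewrite map_inj_uniq// val_ord_tuple enum_uniq.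
rewrite (mean_uniq_tuple _ ue).
have expand (s : 'S_n) :
    \prod_(c < q) h [tuple y (tnth (map_tuple s e) (block c k)) | k < r] =
    \sum_(a in ffun_on (@sorted_subblock r)) \prod_(c < q)
      hajek X h (map_tuple (fun k => y (s (widen_ord qrn (block c k)))) (tagged (a c))).
  transitivity (\prod_(c < q) \sum_(b : subblock r | sorted_subblock b)
      hajek X h (map_tuple (fun k => y (s (widen_ord qrn (block c k)))) (tagged b))).
    apply: eq_bigr => c _; rewrite (hoeffding X)// sig_big_dep/=.
    apply: eq_bigr => b _; congr hajek; apply: eq_from_tnth => i.
    by rewrite !(tnth_map, tnth_ord_tuple).
  exact: bigA_distr_big.
transitivity (\sum_(a in ffun_on (@sorted_subblock r)) M (profile a)).
  under eq_bigr do rewrite expand.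
  rewrite exchange_big/= mulr_sumr; apply: eq_bigr => a sa.
  (* For a fixed choice [a], the average over permutations is again a mean over distinct indices,
     now of the tensor kernel. *)
  have [t ut tE] := prod_hajek_tensor inj_e sa.
  rewrite /M -(tag_hajek_tensor X h) (mean_uniq_tuple _ ut); congr (_ * _).
  apply: eq_bigr => s _; rewrite (tE (y \o s)).
  congr (tagged (hajek_tensor X h (profile a)) _).
  by apply: eq_from_tnth => i; rewrite !tnth_map.
rewrite (partition_big (@profile r q) (fun alpha => alpha_size alpha == q)); last first.
  by move=> a _; rewrite alpha_size_profile.
apply: eq_bigr => alpha _.
rewrite (eq_bigr (fun=> M alpha)) => [|a /andP[_ /eqP->]//].
by rewrite sumr_const -[LHS]mulr_natl.
Qed.

End decomposition.

Local Open Scope classical_set_scope.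

(** * Laws of tuples of distinct observations *)

Section law.
Context {d d' : measure_display} {Omega : measurableType d}
  {V : measurableType d'} {R : realType}.
Variables (P : probability Omega R) (X : nat -> {RV P >-> V}).

(** Measurable rectangles are stable under intersection and generate the product sigma-algebra, so
    they determine a probability. *)
Lemma eq_law_tuple v (f g : Omega -> v.-tuple V) :
  measurable_fun [set: Omega] f -> measurable_fun [set: Omega] g ->
  (forall A : 'I_v -> set V, (forall i, measurable (A i)) ->
    P [set w | forall i, A i (tnth (f w) i)] =
    P [set w | forall i, A i (tnth (g w) i)]) ->
  forall B, measurable B -> P (f @^-1` B) = P (g @^-1` B).
Proof.
move=> mf mg fg B mB.
pose f' : {RV P >-> v.-tuple V} := HB.pack f (isMeasurableFun.Build _ _ _ _ f mf).
pose g' : {RV P >-> v.-tuple V} := HB.pack g (isMeasurableFun.Build _ _ _ _ g mg).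
pose G : set (set (v.-tuple V)) := [set B | exists2 A : 'I_v -> set V,
  (forall i, measurable (A i)) & B = [set x | forall i, A i (tnth x i)]].
have mG : G `<=` measurable.
  move=> _ [A mA ->].
  have -> : [set x : v.-tuple V | forall i, A i (tnth x i)] =
      \bigcap_(i in [set: 'I_v]) ((fun x => tnth x i) @^-1` A i).
    by apply/seteqP; split => x /= h i; [move=> _; exact: h|exact: h].
  apply: fin_bigcap_measurable => // i _.
  by rewrite -[X in measurable X]setTI; exact: measurable_tnth.
apply: (@measure_unique _ R _ G (fun=> setT) _ _ _ _
  (distribution P f') (distribution P g')) => //.
- apply/seteqP; split; last first.
    by apply: smallest_sub => //; exact: sigma_algebra_measurable.
  apply: sub_smallest2r; first exact: smallest_sigma_algebra.
  rewrite -bigcup_seq => _ [i _ [A mA <-]].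
  (* A generator constrains one coordinate; it is the rectangle whose other sides are the whole
     space. *)
  exists (fun j => if j == i then A else setT) => [j|]; first by case: ifP.
  rewrite setTI; apply/seteqP; split => x /=.
    by move=> Ax j; case: eqP => // ->.
  by move=> /(_ i); rewrite eqxx.
- move=> _ _ [A mA ->] [B' mB' ->]; exists (fun i => A i `&` B' i).
    by move=> i; exact: measurableI.
  apply/seteqP; split => x /=; first by move=> [a b] i; split.
  by move=> h; split => i; case: (h i).
- by move=> _; exists (fun=> setT) => //; apply/seteqP; split.
- by rewrite bigcup_const//; exists 0%N.
- by move=> _ [A mA ->]; exact: fg.
- by move=> _; apply: (le_lt_trans (probability_le1 (distribution P f') _)); rewrite ?ltry.
Qed.

Lemma measurable_sub_tuple v n (j : v.-tuple 'I_n) :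
  measurable_fun [set: Omega] (fun w => map_tuple (fun i : 'I_n => X i w) j).
Proof.
apply/measurable_fun_tnthP => i.
rewrite (_ : _ \o _ = X (tnth j i)); first exact: measurable_funP.
by apply/funext => w; rewrite /= tnth_map.
Qed.

Lemma iid_rectangle v n (j : v.-tuple 'I_n) (A : 'I_v -> set V) :
  iid n X -> uniq j -> (forall i, measurable (A i)) ->
  P [set w | forall i, A i (X (tnth j i) w)] =
  (\prod_(i < v) P (X (tnth j i) @^-1` A i))%E.
Proof.
move=> [ind _] uj mA.
have inj_j : injective (tnth j) by exact/tuple_uniqP.
(* The sides are moved from positions to observations: [B k] is the side at the position of [k] in
   [j], and the whole space, as an empty intersection, when [k] is not in [j]. *)
pose B (k : 'I_n) := \bigcap_(i in [set i | tnth j i = k]) A i.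
have BE i : B (tnth j i) = A i.
  apply/seteqP; split => x; first by apply.
  by move=> Ax i' /= /inj_j ->.
have mB k : measurable (B k) by apply: fin_bigcap_measurable.
have := ind [set k in j]%SET B mB.
have -> : \bigcap_(i in [set` [set k in j]%SET]) (X i @^-1` B i) =
    [set w | forall i, A i (X (tnth j i) w)].
  apply/seteqP; split => w /=.
    by move=> h i; rewrite -BE; apply: h; rewrite /= inE mem_tnth.
  by move=> h k /=; rewrite inE => /tnthP[i ->]; rewrite BE.
move=> ->.
transitivity (\prod_(k in [set tnth j i | i in 'I_v]%SET) P (X k @^-1` B k))%E.
  apply: eq_bigl => k; rewrite inE; apply/tnthP/imsetP => -[i]; first by exists i.
  by exists i.
rewrite big_imset/=; last by move=> a b _ _; exact: inj_j.
by apply: eq_bigr => i _; rewrite BE.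
Qed.

Lemma iid_law v n (j k : v.-tuple 'I_n) (B : set (v.-tuple V)) :
  iid n X -> uniq j -> uniq k -> measurable B ->
  P [set w | B (map_tuple (fun i : 'I_n => X i w) j)] =
  P [set w | B (map_tuple (fun i : 'I_n => X i w) k)].
Proof.
move=> Xiid uj uk.
apply: eq_law_tuple; [exact: measurable_sub_tuple|exact: measurable_sub_tuple|].
move=> A mA.
have E (l : v.-tuple 'I_n) :
    [set w | forall i, A i (tnth (map_tuple (fun i : 'I_n => X i w) l) i)] =
    [set w | forall i, A i (X (tnth l i) w)].
  by apply/seteqP; split => w /= h i; have := h i; rewrite tnth_map.
rewrite !E !iid_rectangle//; apply: eq_bigr => i _.
by case: Xiid => _; apply.
Qed.

Lemma measurable_projected_kernel r (h : r.-tuple V -> R) t :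
  measurable_fun [set: r.-tuple V] h ->
  measurable_fun [set: t.-tuple V] (projected_kernel X h (t := t)).
Proof.
move=> mh.
pose F (z : t.-tuple V * Omega) : \bar R :=
  (h [tuple nth (X i z.2) z.1 i | i < r])%:E.
have mF : measurable_fun [set: t.-tuple V * Omega] F.
  apply/measurable_EFinP; apply: measurableT_comp => //.
  apply/measurable_fun_tnthP => i.
  have [it|ti] := ltnP i t.
    rewrite (_ : _ \o _ = (fun x => tnth x (Ordinal it)) \o fst).
      by apply: measurableT_comp => //; exact: measurable_tnth.
    by apply/funext => z; rewrite /= tnth_mktuple (tnth_nth (X i z.2)).
  rewrite (_ : _ \o _ = X i \o snd); first exact: measurableT_comp.
  by apply/funext => z; rewrite /= tnth_mktuple nth_default// size_tuple.
(* By Tonelli the integrals of the positive and negative parts depend measurably on [x], even where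
   they are infinite. *)
rewrite (_ : projected_kernel X h (t := t) = fine \o
    (fun x => fubini_F P (F^\+)%E x - fubini_F P (F^\-)%E x)%E).
  apply: measurableT_comp => //.
  apply: emeasurable_funB; apply: measurable_fun_fubini_tonelli_F => //.
    exact: measurable_funepos.
  exact: measurable_funeneg.
apply/funext => x; rewrite /projected_kernel unlock /fubini_F /=.
rewrite (integralE P setT (fun w => F (x, w))).
by congr (fine (_ - _)); apply: eq_integral => w _; rewrite ?funeposE ?funenegE.
Qed.

(** Nullity is assumed at the first [v] observations; equality of laws moves it to any [v] distinct
    ones, the set where the projected kernel is nonzero being measurable. *)
Lemma projected_kernel_null_ae r (h : r.-tuple V -> R) v n (j : v.-tuple 'I_n) :
  iid n X -> measurable_fun [set: r.-tuple V] h -> projected_kernel_null X h v ->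
  uniq j ->
  {ae P, forall w, projected_kernel X h (map_tuple (fun i : 'I_n => X i w) j) = 0}.
Proof.
move=> Xiid mh nul uj.
have vn : (v <= n)%N.
  by rewrite -(size_tuple j) -(card_uniqP uj) -[leqRHS]card_ord max_card.
pose k := map_tuple (widen_ord vn) (ord_tuple v).
have uk : uniq k.
  by rewrite map_inj_uniq ?val_ord_tuple ?enum_uniq//; exact: widen_ord_inj.
pose B := [set x : v.-tuple V | projected_kernel X h x <> 0].
have mB : measurable B.
  rewrite (_ : B = ~` (projected_kernel X h (t := v) @^-1` [set 0])); last by [].
  apply: measurableC; rewrite -[X in measurable X]setTI.
  by apply: measurable_projected_kernel.
have mS (l : v.-tuple 'I_n) :
    measurable [set w | B (map_tuple (fun i : 'I_n => X i w) l)].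
  by rewrite -[X in measurable X]setTI; apply: measurable_sub_tuple.
apply/negligibleP; first exact: mS.
rewrite [LHS](iid_law Xiid uj uk mB).
apply/negligibleP; first exact: mS.
apply: negligibleS nul => w /=; congr (projected_kernel _ _ _ <> 0).
by apply: eq_from_tnth => i; rewrite !tnth_map tnth_ord_tuple.
Qed.

End law.

(** * Vanishing of tensor kernels with a degenerate factor *)

Section vanishing.
Variables (V : Type) (R : realType) (n : nat) (y : 'I_n -> V).
Implicit Types f g : ukernel V R.

(** Fixing the values [y] keeps this notion deterministic; probability enters only when [y] is a
    sample outside a null set. *)
Definition vanishing f : Prop :=
  forall j : (tag f).-tuple 'I_n, uniq j -> tagged f (map_tuple y j) = 0.

Lemma vanishing_tensorl f g : vanishing f -> vanishing (tensor f g).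
Proof.
move=> f0 j /tuple_uniqP uj.
have uk : uniq [tuple tnth j (lshift (tag g) i) | i < tag f].
  by apply/tuple_uniqP => a b; rewrite !tnth_mktuple => /uj /lshift_inj.
have := f0 _ uk.
have -> : map_tuple y [tuple tnth j (lshift (tag g) i) | i < tag f] =
    [tuple tnth (map_tuple y j) (lshift (tag g) i) | i < tag f].
  by apply: eq_from_tnth => i; rewrite !(tnth_map, tnth_ord_tuple).
by rewrite /= => ->; rewrite mul0r.
Qed.

Lemma vanishing_tensorr f g : vanishing g -> vanishing (tensor f g).
Proof.
move=> g0 j /tuple_uniqP uj.
have uk : uniq [tuple tnth j (rshift (tag f) i) | i < tag g].
  by apply/tuple_uniqP => a b; rewrite !tnth_mktuple => /uj /rshift_inj.
have := g0 _ uk.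
have -> : map_tuple y [tuple tnth j (rshift (tag f) i) | i < tag g] =
    [tuple tnth (map_tuple y j) (rshift (tag f) i) | i < tag g].
  by apply: eq_from_tnth => i; rewrite !(tnth_map, tnth_ord_tuple).
by rewrite /= => ->; rewrite mulr0.
Qed.

Lemma vanishing_tensor_power m f :
  (0 < m)%N -> vanishing f -> vanishing (tensor_power m f).
Proof. by case: m => // m _; exact: vanishing_tensorl. Qed.

Lemma vanishing_big_tensor (I : eqType) (s : seq I) (F : I -> ukernel V R) t :
  t \in s -> vanishing (F t) ->
  vanishing (\big[@tensor V R/tensor_one V R]_(t <- s) F t).
Proof.
move=> + Ft; elim: s => // a s IH; rewrite in_cons big_cons => /orP[/eqP <-|ts].
  exact: vanishing_tensorl.
by apply: vanishing_tensorr; exact: IH.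
Qed.

End vanishing.

Section degenerate.
Context {d d' : measure_display} {Omega : measurableType d}
  {V : measurableType d'} {R : realType}.
Variables (P : probability Omega R) (X : nat -> {RV P >-> V}).
Variables (r q n : nat) (h : r.-tuple V -> R).

(** The projection of order [t] combines only projected kernels of orders 1 to [t], taken at
    subtuples of [j], whose indices are again distinct. *)
Lemma vanishing_hajek (y : 'I_n -> V) s t : (t < s)%N ->
  (forall v (j : v.-tuple 'I_n), (0 < v < s)%N -> uniq j ->
    projected_kernel X h (map_tuple y j) = 0) ->
  vanishing y (UKernel (hajek X h (t := t))).
Proof.
move=> ts pk0 j uj; rewrite /= /hajek big_nat big1// => v /andP[v0 vt].
rewrite big1 ?mulr0// => i si.
have <- : map_tuple y (map_tuple (tnth j) i) = map_tuple (tnth (map_tuple y j)) i.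
  by apply: eq_from_tnth => k; rewrite !tnth_map.
apply: pk0; first by rewrite v0 (leq_trans _ ts).
rewrite map_inj_uniq; first exact: ltn_sorted_uniq.
exact/tuple_uniqP.
Qed.

Lemma alpha_order_le (alpha : multiindex r q) :
  (alpha_order alpha <= alpha_size alpha * r)%N.
Proof.
rewrite /alpha_order /alpha_size big_distrl/=; apply: leq_sum => t _.
by rewrite mulnC leq_mul2l ltn_ord orbT.
Qed.

(** Otherwise every factor would have order at least [s], and the total order would be at least [s]
    times their number. *)
Lemma alpha_order_lt_support s (alpha : multiindex r q) :
  (alpha_order alpha < alpha_size alpha * s)%N ->
  exists2 t : 'I_r, (t.+1 < s)%N & (0 < alpha t)%N.
Proof.
move=> os; apply/exists_inP; apply: contraLR os.
rewrite negb_exists_in -leqNgt => /forall_inP h0.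
rewrite /alpha_order /alpha_size big_distrl/=; apply: leq_sum => t _.
have [ts|] := ltnP t.+1 s; last by rewrite mulnC leq_mul2r => ->; rewrite orbT.
by have := h0 t ts; rewrite -eqn0Ngt => /eqP ->.
Qed.

End degenerate.
Arguments vanishing_hajek {d d' Omega V R P X r n h}.

(** * Identities for the U-statistics and conclusion *)

Section U_statistics.
Context {d d' : measure_display} {Omega : measurableType d}
  {V : measurableType d'} {R : realType}.
Variables (P : probability Omega R) (X : nat -> {RV P >-> V}).
Variables (L : finType) (r q n : nat) (h : L -> r.-tuple V -> R).

Lemma U_alphaE (alpha : multiindex r q) w :
  U_alpha X n h alpha w = \sum_(l : L) (n ^_ (alpha_order alpha))%:R^-1 *
    \sum_(i : (tag (hajek_tensor X (h l) alpha)).-tuple 'I_n | uniq i)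
      tagged (hajek_tensor X (h l) alpha) (map_tuple (fun k : 'I_n => X k w) i).
Proof.
rewrite /U_alpha mulr_sumr; apply: eq_bigr => l _; congr (_ * _).
apply: eq_bigr => i _; congr (tagged (hajek_tensor X (h l) alpha) _).
by apply: eq_from_tnth => j; rewrite !(tnth_map, tnth_ord_tuple).
Qed.

Lemma U_q_alpha w : (0 < r)%N -> (q * r <= n)%N ->
  U_q X q n h w = \sum_(alpha : multiindex r q | alpha_size alpha == q)
    (alpha_count alpha)%:R * U_alpha X n h alpha w.
Proof.
move=> r0 qrn; rewrite /U_q.
under eq_bigr => l _.
  rewrite (mean_prod_kernel X (h l) (fun i : 'I_n => X i w) r0 qrn); over.
rewrite exchange_big/=; apply: eq_bigr => alpha _.
by rewrite U_alphaE mulr_sumr.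
Qed.

Lemma U_alpha_degenerate s (alpha : multiindex r q) w :
  (forall l v (j : v.-tuple 'I_n), (0 < v < s)%N -> uniq j ->
    projected_kernel X (h l) (map_tuple (fun k : 'I_n => X k w) j) = 0) ->
  (alpha_order alpha < alpha_size alpha * s)%N -> U_alpha X n h alpha w = 0.
Proof.
move=> pk0 /alpha_order_lt_support[t ts at0].
rewrite U_alphaE big1// => l _; rewrite big1 ?mulr0// => i ui.
suff : vanishing (fun k : 'I_n => X k w) (hajek_tensor X (h l) alpha) by apply.
apply: (vanishing_big_tensor (mem_index_enum t)).
by apply: vanishing_tensor_power => //; exact: vanishing_hajek ts (pk0 l).
Qed.

Lemma ae_projected_kernel0 s : iid n X ->
  (forall l, measurable_fun [set: r.-tuple V] (h l)) ->
  (forall l t, (1 <= t < s)%N -> projected_kernel_null X (h l) t) ->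
  {ae P, forall w, forall l v (j : v.-tuple 'I_n), (0 < v < s)%N -> uniq j ->
    projected_kernel X (h l) (map_tuple (fun k : 'I_n => X k w) j) = 0}.
Proof.
move=> Xiid mh null.
(* With [v] in ['I_s], all quantifiers range over finite types, so finitely many null sets are
   removed. *)
have : {ae P, forall w, forall (l : L) (v : 'I_s) (j : v.-tuple 'I_n),
    (0 < v)%N -> uniq j ->
    projected_kernel X (h l) (map_tuple (fun k : 'I_n => X k w) j) = 0}.
  apply: filter_forall => l; apply: filter_forall => v; apply: filter_forall => j.
  have [v0|] := boolP ((0 < v)%N); last by move=> v0; apply: filterE.
  have [uj|nuj] := boolP (uniq j); last by apply: filterE.
  have vnull : projected_kernel_null X (h l) v by apply: null; rewrite v0 ltn_ord.
  by apply: filterS (projected_kernel_null_ae Xiid (mh l) vnull uj) => w.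
apply: filterS => w H l v j /andP[v0 vs]; exact: (H l (Ordinal vs) j v0).
Qed.

End U_statistics.

Theorem lemma3p2 (R : realType) (r q : nat) (hq : (1 <= q)%N) :
  exists C : multiindex r q -> R,
    (forall alpha, 0 < C alpha) /\
    forall (s : nat) (d : measure_display) (Omega : measurableType d)
      (P : probability Omega R) (p n : nat)
      (X : nat -> {RV P >-> p.-tuple R}) (L : finType)
      (h : L -> r.-tuple (p.-tuple R) -> R),
      (1 <= s <= r)%N -> (q * r <= n)%N ->
      iid n X ->
      (forall l, symmetric_kernel (h l)) ->
      (forall l, integrable_kernel X (h l)) ->
      (forall l, mean_zero_kernel X (h l)) ->
      (forall l, degeneracy_order X (h l) s) ->
      {ae P, forall w,
        U_q X q n h w =
        \sum_(q * s <= c < (q * r).+1)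
          \sum_(alpha : multiindex r q |
                 (alpha_size alpha == q) && (alpha_order alpha == c))
            C alpha * U_alpha X n h alpha w}.
Proof.
(* The value 1 is junk: only the alpha of size q occur in the sum. *)
exists (fun alpha => if alpha_size alpha == q then (alpha_count alpha)%:R else 1).
split=> [alpha|].
  by case: eqP => // /alpha_count_gt0; rewrite ltr0n.
move=> s d Omega P p n X L h /andP[s1 sr] qrn Xiid _ mh _ deg.
have mh' l : measurable_fun [set: r.-tuple (p.-tuple R)] (h l) by case: (mh l).
have null l t : (1 <= t < s)%N -> projected_kernel_null X (h l) t.
  by case: (deg l) => + _; apply.
apply: filterS (ae_projected_kernel0 Xiid mh' null) => w pk0.
rewrite (U_q_alpha X h w (leq_trans s1 sr) qrn).
(* Each [alpha] occurs for the single value [c = alpha_order alpha], provided that it lies in the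
   range of summation. *)
rewrite (exchange_big_dep (fun alpha : multiindex r q => alpha_size alpha == q))/=;
  last by move=> c alpha _ /andP[].
apply: eq_bigr => alpha /eqP aq; rewrite aq eqxx/=.
under eq_bigl => c do rewrite eq_sym.
have oqr : (alpha_order alpha <= q * r)%N by have := alpha_order_le alpha; rewrite aq.
rewrite big_nat1_eq ltnS oqr andbT.
(* Orders below [q * s] are absent from the sum over [c]; their terms are 0 at the present [w]. *)
case: leqP => // oqs.
by rewrite (U_alpha_degenerate pk0) ?mulr0// aq.
Qed.
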